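(* Let $p$ be an odd prime, $n$ a positive integer, $g(x)\in\mathbb{F}_{p^n}[x]$ a Dembowski-Ostrom polynomial, and let $Y:=M_{g,1}$. Let $\alpha_1,\alpha_2,\dots,\alpha_n$ be an $\mathbb{F}_p$-basis of $\mathbb{F}_{p^n}$. Then $g$ is (extended-affine) equivalent to $x^2$ if and only if $Y$ is invertible and the matrix algebra $$\mathbb{F}_p[M_{g,\alpha_1}Y^{-1},M_{g,\alpha_2}Y^{-1},\dots,M_{g,\alpha_n}Y^{-1}]$$ is a field of order $p^n$.
   Context: A Dembowski-Ostrom (DO) polynomial in $\mathbb{F}_{p^n}[x]$ is one of the form $\sum_{0\le i\le j\le n-1}u_{i,j}x^{p^i+p^j}$ with $u_{i,j}\in\mathbb{F}_{p^n}$. A linearized polynomial is one of the form $\sum_i u_ix^{p^i}$, $u_i\in\mathbb{F}_{p^n}$; it is a linearized permutation polynomial if its evaluation map on $\mathbb{F}_{p^n}$ is bijective. Fix an $\mathbb{F}_p$-basis of $\mathbb{F}_{p^n}$, so that each linearized polynomial is associated with the $n\times n$ matrix over $\mathbb{F}_p$ of the $\mathbb{F}_p$-linear map it induces. For a DO polynomial $g$ and $\alpha\in\mathbb{F}_{p^n}$, $\Delta_{g,\alpha}(x)=g(x+\alpha)-g(x)-g(\alpha)$ is a linearized polynomial, and $M_{g,\alpha}$ denotes its associated matrix. For matrices $A_1,\dots,A_t$, $\mathbb{F}_p[A_1,\dots,A_t]$ is the $\mathbb{F}_p$-algebra generated by them, i.e., the intersection of all subrings of $\mathrm{Mat}_{\mathbb{F}_p}(n,n)$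 containing them. Two polynomials $g,g'\in\mathbb{F}_{p^n}[x]/(x^{p^n}-x)$ are (extended-affine) equivalent if there exist linearized permutation polynomials $L,L'$, a linearized polynomial $L''$, and $u,v,w\in\mathbb{F}_{p^n}$ with $g'(x)=L'(g(L(x)+u))+v+L''(x)+w \bmod (x^{p^n}-x)$. *)

(* Defs.v *)
From mathcomp Require Export all_boot all_algebra all_field.

Set Implicit Arguments.
Unset Strict Implicit.
Unset Printing Implicit Defensive.

Import GRing.Theory.
Local Open Scope ring_scope.

(* The field with p^n elements is a field extension L of 'F_p (p prime) of    *)
(* dimension n; its elements form an 'F_p-vector space in the library sense.  *)

Section Polynomials.

Variables (p n : nat) (L : fieldExtType 'F_p).
Implicit Types (P g h : {poly L}) (a x : L) (e : n.-tuple L).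

Definition dembowski_ostrom g : Prop :=
  exists u : 'I_n -> 'I_n -> L,
    g = \sum_(i < n) \sum_(j < n | (i <= j)%N) u i j *: 'X^(p ^ i + p ^ j).

Definition linearized P : Prop :=
  exists (m : nat) (u : 'I_m -> L), P = \sum_(i < m) u i *: 'X^(p ^ i).

Definition linearized_permutation P : Prop :=
  linearized P /\ bijective (fun x => P.[x]).

(* Polynomials stand for their classes modulo 'X^(p ^ n) - 'X.                *)
Definition ea_equivalent g h : Prop :=
  exists P P' P'' : {poly L}, exists u v w : L,
    [/\ linearized_permutation P,
        linearized_permutation P',
        linearized P''
      & h %% ('X^(p ^ n) - 'X) =
        ((P' \Po (g \Po (P + u%:P))) + v%:P + P'' + w%:P)
          %% ('X^(p ^ n) - 'X)].

Definition Delta g a : {poly L} := g \Po ('X + a%:P) - g - g.[a]%:P.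

(* Column convention: column j holds the coordinates of the image of the j-th *)
(* basis vector, so that *m corresponds to the composition of maps (whereas   *)
(* the library's mxof acts on row vectors).                                   *)
Definition lin_poly_mx e P : 'M['F_p]_n :=
  \matrix_(i, j) coord e i P.[tnth e j].

Definition DO_mx e g a : 'M['F_p]_n := lin_poly_mx e (Delta g a).

End Polynomials.

Section Subrings.

Variables (K : finFieldType) (n : nat).
Implicit Type S : {set 'M[K]_n}.

(* Boolean form of the library's Prop-valued subring_closed.                  *)
Definition subringb S : bool :=
  [&& 1 \in S,
      [forall x in S, forall y in S, x - y \in S]
    & [forall x in S, forall y in S, x * y \in S]].

Lemma subringP S : reflect (subring_closed (mem S)) (subringb S).
Proof.
apply: (iffP and3P) => [[S1 SB SM]|[S1 SB SM]]; split=> //.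
- by move=> x y xS yS; exact: (forall_inP (forall_inP SB x xS)).
- by move=> x y xS yS; exact: (forall_inP (forall_inP SM x xS)).
- by apply/forall_inP=> x xS; apply/forall_inP=> y; exact: SB.
- by apply/forall_inP=> x xS; apply/forall_inP=> y; exact: SM.
Qed.

(* For K a prime field, subrings are automatically subalgebras.              *)
Definition generated_subring (t : nat) (A : 'I_t -> 'M[K]_n) : {set 'M[K]_n} :=
  \bigcap_(S : {set 'M[K]_n} | subringb S && [forall i, A i \in S]) S.

Definition is_subfield S : Prop :=
  [/\ subring_closed (mem S),
      1 != 0 :> 'M[K]_n,
      {in S &, forall x y, x * y = y * x}
    & {in S, forall x, x != 0 -> exists2 y, y \in S & x * y = 1}].

End Subrings.

(* Main.v *)
(* Let B(x, y) = g(x + y) - g(x) - g(y), a symmetric biadditive map with      *)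
(* B(x, x) = 2 g(x).  Polarization shows that g is equivalent to x^2 iff      *)
(* B(x, y) = N (Q x * Q y) for some additive bijections N and Q.  Then        *)
(* M_a Y^-1 = N o (multiplication by Q a / Q 1) o N^-1, and these maps form a *)
(* field isomorphic to L.  Conversely, if the M_a Y^-1 generate a field of    *)
(* order p^n, they exhaust it by injectivity of a |-> M_a Y^-1, so            *)
(* M_a Y^-1 = phi (psi a) for an isomorphism phi from L and an additive       *)
(* bijection psi; taking N d = phi d v with v != 0 gives                      *)
(* B(x, a) = N (psi a * rho x), and the symmetry of B forces                  *)
(* rho x = psi x * rho 1.                                                     *)
Require Import Defs.
From HB Require Import structures.
From mathcomp Require Import fingroup cyclic ring.
Import GRing.Theory.
Local Open Scope ring_scope.

Set Implicit Arguments.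
Unset Strict Implicit.
Unset Printing Implicit Defensive.

(** Reduction modulo ['X^(p ^ n) - 'X] keeps exactly the function on L, and linearized polynomials
    induce exactly the additive maps ([zmod_morphism_linearized]), so equivalence is a statement
    about functions ([ea_equivalent_funP]). The second difference F(x+y) - F(x) - F(y) + F(0) erases
    constants and additive terms and turns x^2 into 2xy; as 2 is invertible, equivalence to x^2
    amounts to [polar_isotopic_to_mul] ([ea_equivalent_square]). For the matrix condition,
    [polar_isotopic_field] conjugates the multiplications of L by N, while [field_polar_isotopic]
    recovers N and Q from an identification of the algebra with L. That identification comes from
    [subfield_embedding]: uniqueness of the field of order p^n, proved inside the matrix ring by
    counting roots of X^(p^n) - X. *)

(** * Additive maps and their automatic F_p-linearity *)

Section AdditiveMaps.

Lemma zmod_morphismD (U V : zmodType) (f : U -> V) :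
  {morph f : x y / x + y} -> zmod_morphism f.
Proof. by move=> fD x y; rewrite -{2}(subrK y x) (fD (x - y)) addrK. Qed.

Lemma zmod_morphism_comp (U V W : zmodType) (f : V -> W) (h : U -> V) :
  zmod_morphism f -> zmod_morphism h -> zmod_morphism (f \o h).
Proof. by move=> fB hB x y /=; rewrite hB fB. Qed.

Lemma zmod_morphism_can (U V : zmodType) (f : U -> V) (h : V -> U) :
  zmod_morphism f -> cancel f h -> cancel h f -> zmod_morphism h.
Proof.
by move=> fB fK hK x y; apply: (can_inj fK); rewrite fB !hK.
Qed.

Section Theory.

Variables (U V : zmodType) (f : U -> V).
Hypothesis fB : zmod_morphism f.

Let F : {additive U -> V} :=
  HB.pack f (GRing.isZmodMorphism.Build U V f fB).

Lemma zmorph0 : f 0 = 0. Proof. exact: (raddf0 F). Qed.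
Lemma zmorphD : {morph f : x y / x + y}. Proof. exact: (raddfD F). Qed.
Lemma zmorphMn k : {morph f : x / x *+ k}. Proof. exact: (raddfMn F). Qed.
Lemma zmorph_sum I (r : seq I) (P : pred I) (h : I -> U) :
  f (\sum_(i <- r | P i) h i) = \sum_(i <- r | P i) f (h i).
Proof. exact: (raddf_sum F). Qed.

Lemma zmorph_inj : (forall x, f x = 0 -> x = 0) -> injective f.
Proof.
move=> f0 x y /eqP; rewrite -subr_eq0 -fB => /eqP/f0/eqP.
by rewrite subr_eq0 => /eqP.
Qed.

End Theory.

Lemma zmorph_Fp_scalable p (U V : lmodType 'F_p) (f : U -> V) :
  zmod_morphism f -> scalable f.
Proof.
by move=> fB c x; rewrite -[c]natr_Zp !scaler_nat; apply: (zmorphMn fB).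
Qed.

End AdditiveMaps.

(** * Linearized polynomials as additive maps *)

Section LinearizedPolynomials.

Variables (p : nat) (L : fieldExtType 'F_p).
Hypothesis p_pr : prime p.

Local Notation n := (\dim {:L}).
Local Notation F := (finvect_type L).

Lemma card_fieldExt_Fp : #|F| = (p ^ n)%N.
Proof.
have := card_vspacef (F := 'F_p) (Vector.on F).
by move <-; rewrite card_vspace card_Fp.
Qed.

Lemma expr_card_fieldExt (x : L) : x ^+ (p ^ n) = x.
Proof. by rewrite -card_fieldExt_Fp; exact: (@expf_card F). Qed.

Lemma frobenius_zmod_morphism i : zmod_morphism (fun x : L => x ^+ (p ^ i)).
Proof.
apply: zmod_morphismD => x y; apply: exprDn_pchar.
by rewrite pnatX pnatE // pchar_lalg pchar_Fp.
Qed.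

(** ['X^(p ^ n) - 'X] is the product of the ['X - x%:P] over all x in L, hence divides every
    polynomial vanishing on L. *)
Lemma eq_modp_horner (P Q : {poly L}) :
  P %% ('X^(p ^ n) - 'X) = Q %% ('X^(p ^ n) - 'X) <->
  forall x, P.[x] = Q.[x].
Proof.
set G := 'X^(p ^ n) - 'X.
have G0 x : G.[x] = 0 by rewrite !hornerE expr_card_fieldExt subrr.
split=> [eqPQ x | eqPQ].
  by rewrite (divp_eq P G) (divp_eq Q G) !hornerD !hornerM G0 !mulr0 !add0r eqPQ.
apply/eqP; rewrite -subr_eq0 -modpN -modpD; apply/eqP/modp_eq0P.
have -> : G = \prod_(x : F) ('X - x%:P).
  by rewrite /G -card_fieldExt_Fp; exact: (finField_genPoly F).
rewrite -big_enum; apply: (@uniq_roots_dvdp L); last first.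
  by rewrite uniq_rootsE; exact: (enum_uniq F).
by apply/allP=> x _; rewrite rootE !hornerE eqPQ subrr.
Qed.

Lemma linearized_zmod_morphism (P : {poly L}) :
  linearized P -> zmod_morphism (horner P).
Proof.
move=> [m [u ->]] x y; rewrite !horner_sum -sumrB; apply: eq_bigr => i _.
by rewrite !hornerZ !hornerXn frobenius_zmod_morphism mulrBr.
Qed.

(* The Moore matrix of a basis is invertible because a nonzero linearized     *)
(* polynomial of degree less than p ^ n cannot vanish on all of L.            *)
Lemma zmod_morphism_linearized (f : L -> L) :
  zmod_morphism f -> exists2 P : {poly L}, linearized P & horner P =1 f.
Proof.
move=> fB; pose b := vbasis {:L}.
pose Moore : 'M[L]_n := \matrix_(i, j) tnth b j ^+ (p ^ i).
pose lin (u : 'rV[L]_n) := \sum_(i < n) u 0 i *: 'X^(p ^ i).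
have linL u : linearized (lin u) by exists n, (u 0).
have linE u j : (lin u).[tnth b j] = (u *m Moore) 0 j.
  rewrite horner_sum mxE; apply: eq_bigr => i _.
  by rewrite hornerZ hornerXn mxE.
have eq_on_basis (h k : L -> L) : zmod_morphism h -> zmod_morphism k ->
    (forall j, h (tnth b j) = k (tnth b j)) -> h =1 k.
  move=> hB kB hk x; rewrite (coord_vbasis (memvf x)).
  rewrite (zmorph_sum hB) (zmorph_sum kB); apply: eq_bigr => j _.
  by rewrite !zmorph_Fp_scalable // -tnth_nth hk.
have Moore_unit : Moore \in unitmx.
  rewrite -row_free_unit -kermx_eq0; apply/eqP/row_matrixP => i; rewrite row0.
  set u := row i _; have uM : u *m Moore = 0.
    by apply/sub_kermxP; exact: row_sub.
  have lin0 : horner (lin u) =1 fun=> 0.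
    apply: eq_on_basis => [||j].
    - exact: linearized_zmod_morphism (linL u).
    - by move=> x y; rewrite subrr.
    - by rewrite linE uM mxE.
  have slin : (size (lin u) <= p ^ n)%N.
    apply: (leq_trans (size_sum _ _ _)); apply/bigmax_leqP => k _.
    rewrite (leq_trans (size_scale_leq _ _)) // size_polyXn.
    by rewrite ltn_exp2l ?prime_gt1.
  have lin00 : lin u = 0.
    apply/eqP; apply: contraLR slin => lin_neq0; rewrite -ltnNge.
    rewrite -card_fieldExt_Fp cardE; apply: (@max_poly_roots L) => //.
      by apply/allP => x _; rewrite rootE lin0.
    exact: (enum_uniq F).
  apply/rowP=> k; have := congr1 (coefp (p ^ k)) lin00.
  rewrite /= coef0 coef_sum (bigD1 k) //= big1 => [|l lk]; last first.
    rewrite coefZ coefXn eqn_exp2l ?prime_gt1 // eq_sym (inj_eq val_inj).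
    by rewrite (negPf lk) mulr0.
  by rewrite coefZ coefXn eqxx mulr1 addr0 => ->; rewrite mxE.
(* Interpolation: these coefficients solve the linear system prescribing the values of f on the
   basis. *)
exists (lin ((\row_j f (tnth b j)) *m invmx Moore)) => //.
apply: eq_on_basis => [|//|j]; first exact: linearized_zmod_morphism.
by rewrite linE mulmxKV // mxE.
Qed.

Lemma ea_equivalent_funP (g h : {poly L}) :
  ea_equivalent n g h <->
  exists f f' f'' : L -> L, exists u v w : L,
    [/\ zmod_morphism f /\ bijective f, zmod_morphism f' /\ bijective f',
        zmod_morphism f''
      & forall x, h.[x] = f' g.[f x + u] + v + f'' x + w].
Proof.
split=> [[P [P' [P'' [u [v [w]]]]]]|].
  move=> [[lP bP] [lP' bP'] lP'' /eq_modp_horner eq_h].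
  exists (horner P), (horner P'), (horner P''), u, v, w.
  split; try split; try exact: linearized_zmod_morphism; try by [].
  by move=> x; rewrite eq_h !hornerD !horner_comp !hornerD !hornerC.
move=> [f [f' [f'' [u [v [w [[fB f_bij] [f'B f'_bij] f''B eq_h]]]]]]].
have [P lP PE] := zmod_morphism_linearized fB.
have [P' lP' P'E] := zmod_morphism_linearized f'B.
have [P'' lP'' P''E] := zmod_morphism_linearized f''B.
exists P, P', P'', u, v, w; split=> //.
- by split=> //; exact: eq_bij f_bij _ (fsym PE).
- by split=> //; exact: eq_bij f'_bij _ (fsym P'E).
apply/eq_modp_horner=> x.
by rewrite eq_h !hornerD !horner_comp !hornerD !hornerC PE P'E P''E.
Qed.

End LinearizedPolynomials.

(** * The polar form of a Dembowski-Ostrom polynomial *)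

Section Polarization.

Variables (p : nat) (L : fieldExtType 'F_p).
Hypothesis p_pr : prime p.

Lemma horner_Delta (g : {poly L}) a x :
  (Delta g a).[x] = g.[x + a] - g.[x] - g.[a].
Proof. by rewrite !hornerD !hornerN horner_comp hornerD hornerX !hornerC. Qed.

Lemma horner_DeltaC (g : {poly L}) a x : (Delta g a).[x] = (Delta g x).[a].
Proof. by rewrite !horner_Delta [a + x]addrC addrAC. Qed.

(** Separating the two factors of x^(p^i) x^(p^j) gives b, in general not symmetric; [Delta g a] is
    then x |-> b x a + b a x. *)
Lemma dembowski_ostrom_bilinear n (g : {poly L}) :
  dembowski_ostrom n g ->
  exists b : L -> L -> L,
    [/\ forall x, zmod_morphism (b x), forall y, zmod_morphism (b ^~ y)
      & forall x, g.[x] = b x x].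
Proof.
move=> [u ->].
exists (fun x y => \sum_(i < n) \sum_(j < n | (i <= j)%N)
          u i j * (x ^+ (p ^ i) * y ^+ (p ^ j))).
split=> [x y z | y x z | x].
- rewrite -sumrB; apply: eq_bigr => i _; rewrite -sumrB; apply: eq_bigr => j _.
  by rewrite frobenius_zmod_morphism // !mulrBr.
- rewrite -sumrB; apply: eq_bigr => i _; rewrite -sumrB; apply: eq_bigr => j _.
  by rewrite frobenius_zmod_morphism // !mulrBl !mulrBr.
rewrite horner_sum; apply: eq_bigr => i _.
rewrite horner_sum; apply: eq_bigr => j _.
by rewrite hornerZ hornerXn exprD.
Qed.

Lemma Delta_zmod_morphism n (g : {poly L}) a :
  dembowski_ostrom n g -> zmod_morphism (horner (Delta g a)).
Proof.
move=> /dembowski_ostrom_bilinear[b [bl br gE]].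
have DE x : (Delta g a).[x] = b x a + b a x.
  rewrite horner_Delta !gE (zmorphD (bl _)) !(zmorphD (br _)).
  by rewrite addrA [LHS]addrAC addrK -(addrA (b x x)) [LHS]addrAC subrr add0r
             addrC.
by move=> x y; rewrite !DE bl br opprD addrACA.
Qed.

(** For odd p this recovers g from its polar form. *)
Lemma Delta_diag n (g : {poly L}) x :
  dembowski_ostrom n g -> (Delta g x).[x] = g.[x] *+ 2.
Proof.
move=> /dembowski_ostrom_bilinear[b [bl br gE]].
rewrite horner_Delta !gE (zmorphD (bl _)) !(zmorphD (br _)).
by rewrite addrA [LHS]addrAC addrK -(addrA (b x x)) [LHS]addrAC subrr add0r.
Qed.

End Polarization.

(** * Coordinates and matrices in a fixed basis *)

Section Coordinates.

Variables (p n : nat) (L : fieldExtType 'F_p) (e : n.-tuple L).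
Hypothesis e_basis : basis_of {:L} e.

Definition coord_col (x : L) : 'cV['F_p]_n := \col_i coord e i x.
Definition col_vec (v : 'cV['F_p]_n) : L := \sum_i v i 0 *: tnth e i.

Definition fun_mx (f : L -> L) : 'M['F_p]_n :=
  \matrix_(i, j) coord e i (f (tnth e j)).

Lemma coord_colK : cancel coord_col col_vec.
Proof.
move=> x; rewrite [RHS](coord_basis e_basis (memvf x)).
by apply: eq_bigr => i _; rewrite mxE (tnth_nth 0).
Qed.

Lemma col_vecK : cancel col_vec coord_col.
Proof.
move=> v; apply/colP=> i; rewrite mxE /col_vec.
under eq_bigr => j _ do rewrite (tnth_nth 0).
by rewrite coord_sum_free // (basis_free e_basis).
Qed.

Lemma coord_col_zmod_morphism : zmod_morphism coord_col.
Proof. by move=> x y; apply/colP=> i; rewrite !mxE linearB. Qed.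

Lemma col_vec_zmod_morphism : zmod_morphism col_vec.
Proof. exact: zmod_morphism_can coord_col_zmod_morphism coord_colK col_vecK. Qed.

Lemma fun_mxE f x :
  zmod_morphism f -> fun_mx f *m coord_col x = coord_col (f x).
Proof.
move=> fB; apply/colP=> i; rewrite !mxE.
rewrite [in RHS](coord_basis e_basis (memvf x)) (zmorph_sum fB) linear_sum.
apply: eq_bigr => j _.
by rewrite !mxE zmorph_Fp_scalable // linearZ /= mulrC -tnth_nth.
Qed.

Lemma coord_col_mx_inj (A B : 'M_n) :
  (forall x, A *m coord_col x = B *m coord_col x) -> A = B.
Proof.
move=> eqAB; apply/trmx_inj/row_matrixP=> i.
by rewrite -!tr_col !colE -(col_vecK (delta_mx i 0)) eqAB.
Qed.

(** Elements of F_p act as integer multiples, so an additive subgroup absorbs all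
    F_p-combinations. *)
Lemma zmod_closed_basis_image (V : zmodType) (S : {pred V}) (T : L -> V) :
  zmod_closed S -> zmod_morphism T -> (forall i, T (tnth e i) \in S) ->
  forall x, T x \in S.
Proof.
move=> [S0 SB] TB Te x.
have SN y : y \in S -> - y \in S by move=> yS; rewrite -sub0r SB.
have SD y z : y \in S -> z \in S -> y + z \in S.
  by move=> yS zS; rewrite -[z]opprK SB ?SN.
rewrite -(coord_colK x) /col_vec (zmorph_sum TB).
elim/big_ind: _ => // i _; rewrite -[_ i 0]natr_Zp scaler_nat (zmorphMn TB).
by elim: (nat_of_ord _) => [|k IHk]; rewrite ?mulr0n // mulrSr SD.
Qed.

End Coordinates.

(** * The generated subring *)

Section GeneratedSubring.

Variables (K : finFieldType) (n t : nat) (A : 'I_t -> 'M[K]_n).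

Lemma mem_generated_subring i : A i \in generated_subring A.
Proof. by apply/bigcapP=> S /andP[_ /forallP]. Qed.

Lemma generated_subring_closed : subring_closed (mem (generated_subring A)).
Proof.
split=> [|x y /bigcapP xA /bigcapP yA|x y /bigcapP xA /bigcapP yA];
  apply/bigcapP=> S SA; have /andP[/subringP[S1 SB SM] _] := SA => //.
- by apply: SB; [apply: xA | apply: yA].
- by apply: SM; [apply: xA | apply: yA].
Qed.

Lemma generated_subring_sub (S : {set 'M[K]_n}) :
  subring_closed (mem S) -> (forall i, A i \in S) ->
  generated_subring A \subset S.
Proof.
move=> Sring AS; apply: bigcap_inf; apply/andP; split; first exact/subringP.
exact/forallP.
Qed.

End GeneratedSubring.

(** * Finite fields made of matrices *)

Section SubfieldOfMatrices.

Variables (p k : nat) (S : {set 'M['F_p]_k.+1}).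
Hypothesis S_field : is_subfield S.

Lemma subfield_unit s : s \in S -> s != 0 -> s \is a GRing.unit.
Proof.
case: S_field => _ _ _ SV sS /(SV s sS)[s' _ ss'].
by have [] := mulmx1_unit ss'.
Qed.

(** Lagrange's theorem for the group U of nonzero elements of S, which has order #|S| - 1. *)
Lemma subfield_expr_card s : s \in S -> s ^+ #|S| = s.
Proof.
have [[S1 SB SM] one_neq0 _ _] := S_field; move=> sS.
have S0 : 0 \in S by rewrite -(subrr 1) SB.
pose U := [set u : {unit 'M['F_p]_k.+1} | val u \in S].
have U_group : group_set U.
  apply/group_setP; split=> [|u v]; first by rewrite inE.
  by rewrite !inE; exact: SM.
have cardU : #|S| = #|U|.+1.
  rewrite (cardsD1 0 S) S0 -[in RHS](card_imset _ val_inj) add1n; congr _.+1.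
  apply: eq_card => x; rewrite !inE; apply/andP/imsetP => [[x0 xS] | [u]].
    by exists (FinRing.unit _ (subfield_unit xS x0)); rewrite ?inE.
  rewrite inE => uS ->; split=> //; apply: contraTneq (valP u) => /= ->.
  by rewrite unitr0.
have [-> | s0] := eqVneq s 0; first by rewrite cardU expr0n.
pose u : {unit 'M['F_p]_k.+1} := FinRing.unit _ (subfield_unit sS s0).
have uU : u \in Group U_group by rewrite inE.
have := congr1 val (expg_cardG uU); rewrite /= FinRing.val_unitX => us.
by rewrite cardU exprS us mulr1.
Qed.

(** Over a noncommutative ring, [uniq_roots] asks for commuting elements with invertible
    differences, which a field provides. *)
Lemma subfield_uniq_roots (rs : seq 'M['F_p]_k.+1) :
  {subset rs <= S} -> uniq rs -> uniq_roots rs.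
Proof.
have [[_ SB _] _ SC _] := S_field.
elim: rs => //= x rs IHrs rsS /andP[x_rs rs_uniq]; rewrite IHrs ?andbT //.
  apply/allP=> y yrs.
  have [xS yS] : x \in S /\ y \in S.
    by rewrite !rsS ?mem_head // in_cons yrs orbT.
  rewrite /diff_roots SC // eqxx subfield_unit ?SB // subr_eq0.
  by apply: contraNneq x_rs => <-.
by move=> y yrs; rewrite rsS // in_cons yrs orbT.
Qed.

Lemma subfield_horner s q : s \in S -> horner_mx s q \in S.
Proof.
have [[S1 SB SM] _ _ _] := S_field; move=> sS.
have S0 : 0 \in S by rewrite -(subrr 1) SB.
have SD x y : x \in S -> y \in S -> x + y \in S.
  by move=> xS yS; rewrite -[y]opprK SB // -sub0r SB.
elim/poly_ind: q => [|q c IHq]; first by rewrite rmorph0.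
rewrite rmorphD rmorphM /= horner_mx_X SD ?SM // horner_mx_C.
rewrite -[c]natr_Zp raddfMn; elim: (nat_of_ord c) => [|m IHm].
  by rewrite mulr0n.
by rewrite mulrSr SD.
Qed.

End SubfieldOfMatrices.

(** * Embedding L into a matrix field of the same order *)

Section SubfieldEmbedding.

Variables (p k : nat) (L : fieldExtType 'F_p).
Hypothesis p_pr : prime p.

Local Notation n := (\dim {:L}).
Local Notation F := (finvect_type L).
Local Notation ev x q := (map_poly (in_alg L) q).[x].

(** The multiplicative group of L is cyclic, so a primitive root z has every nonzero element among
    its powers. The boolean equality lets [xchoose] pick q. *)
Lemma ex_field_generator :
  exists z : L, forall x, exists q : {poly 'F_p}, x == ev z q.
Proof.
pose rs := [seq x <- enum F | x != 0].
have q_gt1 : (1 < #|F|)%N := finNzRing_gt1 F.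
have rs_size : size rs = #|F|.-1.
  rewrite -(cardC1 (0 : F)) cardE /rs enumT /enum_mem !size_filter.
  exact: eq_count.
have /hasP[z _ z_prim] : has (#|F|.-1).-primitive_root (rs : seq L).
  apply: has_prim_root; rewrite ?rs_size //.
  - by rewrite -ltnS (ltn_predK q_gt1).
  - apply/allP=> x; rewrite mem_filter => /andP[x0 _]; apply/unity_rootP.
    apply: (mulfI x0); rewrite -exprS (ltn_predK q_gt1) mulr1.
    exact: (@expf_card F).
  - by rewrite filter_uniq // (enum_uniq F).
exists z => x; have [->|x0] := eqVneq x 0.
  by exists 0; rewrite rmorph0 horner0.
have [|i ->] := prim_rootP z_prim (x := x).
  apply: (mulfI x0); rewrite -exprS (ltn_predK q_gt1) mulr1.
  exact: (@expf_card F).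
by exists 'X^i; rewrite map_polyXn hornerXn.
Qed.

(* Since X^q - X = h m, where m is the minimal polynomial of z over F_p, and  *)
(* h has fewer than q roots, some element of S is a root of m.                *)
Lemma ex_conjugate (S : {set 'M['F_p]_k.+1}) (z : L) :
  is_subfield S -> #|S| = (p ^ n)%N ->
  exists2 s, s \in S & forall q, ev z q = 0 -> horner_mx s q = 0.
Proof.
move=> S_field S_card.
have [m mE] := polyOver1P (minPolyOver 1%AS z).
have m_root q : ev z q = 0 -> m %| q.
  move=> zq; rewrite -(dvdp_map (in_alg L)) -mE minPoly_dvdp //.
    by apply/polyOver1P; exists q.
  exact/rootP.
have m_size : (1 < size m)%N.
  rewrite -(size_map_poly (in_alg L)) -mE size_minPoly ltnS.
  by rewrite adjoin_degreeE divn_gt0 ?adim_gt0 // dimvS // subv_adjoin.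
have q_gt1 : (1 < p ^ n)%N by rewrite -card_fieldExt_Fp // (finNzRing_gt1 F).
pose G : {poly 'F_p} := 'X^(p ^ n) - 'X.
have G_size : size G = (p ^ n).+1.
  by rewrite size_polyDl size_polyXn // size_polyN size_polyX ltnS.
have /m_root/dvdpP[h hE] : ev z G = 0.
  rewrite rmorphB /= map_polyXn map_polyX !hornerE.
  by rewrite expr_card_fieldExt // subrr.
have /exists_inP[s sS /eqP sm] : [exists s in S, horner_mx s m == 0]; last first.
  by exists s => // q /m_root/dvdpP[r ->]; rewrite rmorphM /= sm mulr0.
(* If no s in S is a root of m, each m(s) is invertible, so all p^n elements of S are roots of h,
   whose size is at most p^n. *)
apply: contraT => /exists_inPn S_m.
have h0 : h != 0.
  by apply: contra_eq_neq G_size => h0; rewrite hE h0 mul0r size_poly0.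
have m0 : m != 0 by rewrite -size_poly_gt0 ltnW.
have h_size : (size h <= p ^ n)%N.
  move: G_size; rewrite hE size_mul // => hm_size.
  rewrite -ltnS -hm_size -subn1 -addnBA ?(ltnW m_size) //.
  by rewrite -addn1 leq_add2l subn_gt0.
suff : (size (enum S) < size (map_poly (@scalar_mx 'F_p k.+1) h))%N.
  by rewrite -cardE S_card size_map_poly ltnNge h_size.
apply: max_ring_poly_roots.
- by rewrite map_poly_eq0.
- apply/allP=> s; rewrite mem_enum => sS; apply/rootP.
  have : horner_mx s G = 0.
    rewrite rmorphB rmorphXn /= horner_mx_X -S_card.
    by rewrite subfield_expr_card // subrr.
  rewrite hE rmorphM /= => hm0.
  have mu : horner_mx s m \is a GRing.unit.
    by rewrite (subfield_unit S_field) ?subfield_horner ?S_m.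
  by apply: (mulIr mu); rewrite mul0r; exact: hm0.
- apply: (subfield_uniq_roots S_field) (enum_uniq S) => s.
  by rewrite mem_enum.
Qed.

(** Send q(z) to q(s), with s the conjugate of z in S; this is well defined because s satisfies
    every polynomial relation of z. *)
Lemma subfield_embedding (S : {set 'M['F_p]_k.+1}) :
  is_subfield S -> #|S| = (p ^ n)%N ->
  exists phi : L -> 'M['F_p]_k.+1,
    [/\ zmod_morphism phi, monoid_morphism phi & forall x, phi x \in S].
Proof.
move=> S_field S_card; have [z z_gen] := ex_field_generator.
have [s sS s_root] := ex_conjugate z S_field S_card.
pose q x := xchoose (z_gen x).
have qE x : ev z (q x) = x by rewrite -(eqP (xchooseP (z_gen x))).
have eq_phi r r' : ev z r = ev z r' -> horner_mx s r = horner_mx s r'.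
  move=> /eqP; rewrite -subr_eq0 -hornerN -hornerD -rmorphB => /eqP/s_root/eqP.
  by rewrite rmorphB subr_eq0 => /eqP.
exists (fun x => horner_mx s (q x)); split; [|split|] => [x y | | x y | x].
- by rewrite -rmorphB; apply: eq_phi; rewrite rmorphB hornerD hornerN !qE.
- by rewrite -(rmorph1 (horner_mx s)); apply: eq_phi; rewrite qE rmorph1 hornerC.
- by rewrite -rmorphM; apply: eq_phi; rewrite rmorphM hornerM !qE.
- exact: subfield_horner.
Qed.

End SubfieldEmbedding.

(** For nonzero c, G c has inverse G c^-1; this gives both injectivity and inverses in the image. *)
Lemma field_image_subfield (K F : finFieldType) k (G : F -> 'M[K]_k.+1) :
  zmod_morphism G -> monoid_morphism G ->
  is_subfield [set G c | c : F] /\ #|[set G c | c : F]| = #|F|.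
Proof.
move=> GB [G1 GM].
have GV c : c != 0 -> G c * G c^-1 = 1 by move=> c0; rewrite -GM mulfV.
split; last first.
  apply: card_imset; apply: zmorph_inj => // c Gc; apply/eqP.
  by apply: contraT => /GV/eqP; rewrite Gc mul0r eq_sym oner_eq0.
split=> [|||_ /imsetP[c _ ->] Gc0]; last 1 first.
- exists (G c^-1); first exact: imset_f.
  by apply: GV; apply: contraNneq Gc0 => ->; rewrite (zmorph0 GB).
- split=> [|_ _ /imsetP[a _ ->] /imsetP[b _ ->]
           |_ _ /imsetP[a _ ->] /imsetP[b _ ->]].
  + by rewrite -G1; exact: imset_f.
  + by rewrite -GB; exact: imset_f.
  + by rewrite -GM; exact: imset_f.
- exact: oner_neq0.
- by move=> _ _ /imsetP[a _ ->] /imsetP[b _ ->]; rewrite -!GM mulrC.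
Qed.

(** Here a, b stand for the additive terms, v, w for the constants, and f0, fx, fy, fxy for values
    of f' o g; the second difference cancels all but d. *)
Lemma second_difference (R : comNzRingType) (x y a b v w d f0 fx fy fxy : R) :
  (x + y) ^+ 2 = fxy + v + (a + b) + w -> x ^+ 2 = fx + v + a + w ->
  y ^+ 2 = fy + v + b + w -> 0 = f0 + v + w ->
  fxy = d + fy - f0 + fx -> d = x * y *+ 2.
Proof.
move=> Exy Ex Ey E0 Ed.
have -> : d = (fxy + v + (a + b) + w) - (fx + v + a + w) - (fy + v + b + w)
              + (f0 + v + w) by rewrite Ed; ring.
by rewrite -Exy -Ex -Ey -E0; ring.
Qed.

(** * Equivalence to x^2, isotopism and the matrix field *)

Section DembowskiOstrom.

Variables (p k : nat) (L : fieldExtType 'F_p) (g : {poly L}).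
Hypotheses (p_pr : prime p) (p_odd : odd p) (dimL : \dim {:L} = k.+1).
Hypothesis g_DO : dembowski_ostrom k.+1 g.

Local Notation F := (finvect_type L).
Local Notation B x y := (Delta g y).[x].

(** In the language of presemifields, a strong isotopism with the field multiplication: the same Q
    acts on both arguments. *)
Definition polar_isotopic_to_mul :=
  exists N Q : L -> L,
    [/\ zmod_morphism N /\ bijective N, zmod_morphism Q /\ bijective Q
      & forall x y, B x y = N (Q x * Q y)].

Lemma two_neq0 : 2%:R != 0 :> L.
Proof.
have pL : p \in [pchar L] by rewrite pchar_lalg pchar_Fp.
rewrite -(dvdn_pcharf pL) dvdn_prime2 //.
by apply: contraTneq p_odd => ->.
Qed.

Lemma mulr2n_inj : injective (fun x : L => x *+ 2).
Proof.
move=> x y /eqP; rewrite -[x *+ 2]mulr_natr -[y *+ 2]mulr_natr.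
by rewrite (inj_eq (mulIf two_neq0)) => /eqP.
Qed.

Lemma mulr2n_bij : bijective (fun x : L => x *+ 2).
Proof. exact: (@injF_bij F _ mulr2n_inj). Qed.

Lemma mulr2n_zmod_morphism : zmod_morphism (fun x : L => x *+ 2).
Proof. by move=> x y; rewrite mulrnBl. Qed.

Lemma ea_equivalent_square :
  ea_equivalent k.+1 g 'X^2 <-> polar_isotopic_to_mul.
Proof.
rewrite -dimL; split=> [/(ea_equivalent_funP p_pr)|].
  move=> [f [f' [f'' [u [v [w]]]]]].
  move=> [[fB f_bij] [f'B [f'i f'K f'iK]] f''B eq_sq].
  have [Q fK QK] := f_bij.
  have gD s t : g.[s + t] = B s t + g.[s] + g.[t].
    by rewrite horner_Delta addrAC !subrK.
  have BD y : {morph (fun x => B x y) : s t / s + t}.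
    exact: (zmorphD (Delta_zmod_morphism p_pr y g_DO)).
  have f'polar x y : f' (B (f x) (f y)) = x * y *+ 2.
    have E z : z ^+ 2 = f' g.[f z + u] + v + f'' z + w.
      by rewrite -eq_sq hornerXn.
    have E0 := E 0.
    rewrite (zmorph0 fB) add0r (zmorph0 f''B) addr0 expr0n /= in E0.
    have Exy := E (x + y); rewrite (zmorphD f''B) in Exy.
    apply: (second_difference Exy (E x) (E y) E0).
    (* The shift by u only adds [B u (f y)], which cancels against the same term of g(u + f y). *)
    rewrite (zmorphD fB) addrAC (gD (f x + u)) BD.
    rewrite [f y + u]addrC (gD u).
    rewrite -(zmorphD f'B) -f'B -(zmorphD f'B); congr f'.
    by rewrite [LHS]addrAC (addrAC (B u (f y))) !addrA addrK.
  have f'iB := zmod_morphism_can f'B f'K f'iK.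
  have QB := zmod_morphism_can fB fK QK.
  (* By [f'polar], B(s, t) is the preimage under f' of 2 Q(s) Q(t). *)
  exists (fun z => f'i (z *+ 2)), Q; split.
  - split; first exact: (zmod_morphism_comp f'iB mulr2n_zmod_morphism).
    by apply: bij_comp mulr2n_bij; exists f'.
  - by split=> //; exists f.
  - by move=> x y; rewrite -[in LHS](QK x) -[in LHS](QK y) -[LHS]f'K f'polar.
move=> [N [Q [[NB [N' NK N'K]] [QB [Q' QK Q'K]] BE]]].
apply/(ea_equivalent_funP p_pr).
(* Since 2 g(x) = B(x, x) = N (Q(x)^2), applying N' to 2 g(Q' x) gives x^2. *)
exists Q', (fun z => N' (z *+ 2)), (fun=> 0), 0, 0, 0; split.
- by split; [exact: zmod_morphism_can QB QK Q'K | exists Q].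
- split; last by apply: bij_comp mulr2n_bij; exists N.
  apply: (zmod_morphism_comp _ mulr2n_zmod_morphism).
  exact: zmod_morphism_can NB NK N'K.
- by move=> x y; rewrite subrr.
move=> x; rewrite !addr0 -(Delta_diag p_pr _ g_DO) BE Q'K NK.
by rewrite hornerXn expr2.
Qed.

Variables e alpha : k.+1.-tuple L.
Hypotheses (e_basis : basis_of {:L} e) (alpha_basis : basis_of {:L} alpha).

Let Y := DO_mx e g 1.
Let T a := DO_mx e g a *m invmx Y.
Let A := generated_subring (fun i : 'I_k.+1 => T (tnth alpha i)).

Lemma DO_mx_col a x : DO_mx e g a *m coord_col e x = coord_col e (B x a).
Proof. exact: fun_mxE e_basis _ _ (Delta_zmod_morphism p_pr a g_DO). Qed.

Lemma DO_mx_zmod_morphism : zmod_morphism (DO_mx e g).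
Proof.
move=> a b; apply: (coord_col_mx_inj e_basis) => x.
rewrite mulmxBl !DO_mx_col -coord_col_zmod_morphism; congr (coord_col e _).
rewrite 3!(horner_DeltaC g _ x).
exact: (Delta_zmod_morphism p_pr x g_DO).
Qed.

Lemma T_zmod_morphism : zmod_morphism T.
Proof. by move=> a b; rewrite /T DO_mx_zmod_morphism mulmxBl. Qed.

Lemma T_generated a : T a \in A.
Proof.
have [A1 AB _] := generated_subring_closed (fun i => T (tnth alpha i)).
have A0 : 0 \in A by rewrite -(subrr 1) AB.
apply: (zmod_closed_basis_image alpha_basis _ T_zmod_morphism) => // i.
exact: mem_generated_subring.
Qed.

Lemma polar_isotopic_field :
  polar_isotopic_to_mul ->
  Y \in unitmx /\ (is_subfield A /\ #|A| = (p ^ k.+1)%N).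
Proof.
move=> [N [Q [[NB [N' NK N'K]] [QB [Q' QK Q'K]] BE]]].
have N'B := zmod_morphism_can NB NK N'K.
have Q'B := zmod_morphism_can QB QK Q'K.
have mulB (c : L) : zmod_morphism (fun x => c * x) by move=> x y; rewrite mulrBr.
pose q1 := Q 1; have q1_neq0 : q1 != 0.
  apply: contra_neq (oner_neq0 L) => q10.
  by apply: (can_inj QK); rewrite (zmorph0 QB).
have Y_unit : Y \in unitmx.
  (* Y represents x |-> N (Q x * q1), and Z its inverse. *)
  pose Z := fun_mx e (fun x => Q' (q1^-1 * N' x)).
  have ZE x : Z *m coord_col e x = coord_col e (Q' (q1^-1 * N' x)).
    by apply: fun_mxE => // s t; rewrite N'B mulB Q'B.
  suff /mulmx1_unit[Yu _] : Y *m Z = 1%:M by exact: Yu.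
  apply: (coord_col_mx_inj e_basis) => x.
  rewrite -mulmxA ZE DO_mx_col BE Q'K -/q1 mulrAC mulVf // mul1r N'K.
  by rewrite mul1mx.
pose G c := fun_mx e (fun x => N (c * N' x)).
have GE c x : G c *m coord_col e x = coord_col e (N (c * N' x)).
  by apply: fun_mxE => // s t; rewrite N'B mulB NB.
(* The multiplier attached to a is c = Q a / q1; solving for a shows that every c occurs. *)
have TG c : T (Q' (c * q1)) = G c.
  apply: (canLR (mulmxK Y_unit)); apply: (coord_col_mx_inj e_basis) => x.
  by rewrite -mulmxA !DO_mx_col GE !BE Q'K NK -/q1 mulrA mulrAC mulrC mulrA.
have GB : zmod_morphism G.
  by move=> b c; rewrite -!TG mulrBl Q'B T_zmod_morphism.
have GM : monoid_morphism G.
  split=> [|b c]; apply: (coord_col_mx_inj e_basis) => x.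
    by rewrite GE mul1r N'K mul1mx.
  by rewrite -mulmxA !GE NK mulrA.
have [G_field G_card] := @field_image_subfield 'F_p F k G GB GM.
suff -> : A = [set G c | c : F].
  by rewrite G_card card_fieldExt_Fp // dimL.
apply/eqP; rewrite eqEsubset; apply/andP; split.
  apply: generated_subring_sub => [|i]; first by case: G_field.
  apply/imsetP; exists (Q (tnth alpha i) / q1) => //.
  by rewrite -TG divfK // QK.
by apply/subsetP=> _ /imsetP[c _ ->]; rewrite -TG T_generated.
Qed.

Lemma field_polar_isotopic :
  Y \in unitmx -> is_subfield A -> #|A| = (p ^ k.+1)%N ->
  polar_isotopic_to_mul.
Proof.
move=> Y_unit A_field A_card.
have T1 : T 1 = 1 by rewrite /T mulmxV.
have [phi [phiB [phi1 phiM] phiA]] : exists phi : L -> 'M['F_p]_k.+1,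
    [/\ zmod_morphism phi, monoid_morphism phi & forall x, phi x \in A].
  by apply: subfield_embedding; rewrite ?dimL.
have phiV d : d != 0 -> phi d^-1 * phi d = 1.
  by move=> d0; rewrite -phiM mulVf.
have phi_inj : injective phi.
  apply: zmorph_inj => // d phid; apply/eqP; apply: contraT => /phiV/eqP.
  by rewrite phid mulr0 eq_sym oner_eq0.
(* L and A have the same order, so the injection [phi] is onto. *)
have phi_onto M : M \in A -> exists d, phi d == M.
  suff -> : A = [set phi d | d : F] by case/imsetP=> d _ ->; exists d.
  apply/esym/eqP.
  rewrite eqEcard (card_imset _ (phi_inj : injective (phi : F -> _))).
  rewrite A_card card_fieldExt_Fp // dimL leqnn andbT.
  by apply/subsetP=> _ /imsetP[d _ ->].
have [psi psiE] : exists psi : L -> L, forall a, phi (psi a) = T a.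
  exists (fun a => xchoose (phi_onto _ (T_generated a))) => a.
  by apply/eqP; exact: (xchooseP (phi_onto _ _)).
have psiB : zmod_morphism psi.
  by move=> a b; apply: phi_inj; rewrite phiB !psiE T_zmod_morphism.
have psi1 : psi 1 = 1 by apply: phi_inj; rewrite psiE T1 phi1.
have col_inj : injective (coord_col e) := can_inj (coord_colK e_basis).
(* If T a = 0 then M_a = 0, so Y a = M_1 a = M_a 1 = 0 by symmetry, and a = 0 because Y is
   invertible. *)
have psi_inj : injective psi.
  apply: zmorph_inj => // a psia.
  have Ta0 : T a = 0 by rewrite -psiE psia (zmorph0 phiB).
  have DOa0 : DO_mx e g a = 0.
    by rewrite -(mulmxKV Y_unit (DO_mx e g a)) -/(T a) Ta0 mul0mx.
  apply: col_inj; rewrite -(mulKmx Y_unit (coord_col e a)) DO_mx_col.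
  rewrite horner_DeltaC -DO_mx_col DOa0 mul0mx mulmx0.
  by rewrite (zmorph0 (coord_col_zmod_morphism e)).
(* A one-dimensional vector space over the field [A] identifies with [A]. *)
pose v := coord_col e 1; pose N d := col_vec e (phi d *m v).
have NE d : coord_col e (N d) = phi d *m v by rewrite col_vecK.
have v0 : v != 0.
  apply: contra_neq (oner_neq0 L) => v0; apply: col_inj.
  by rewrite -/v v0 (zmorph0 (coord_col_zmod_morphism e)).
have NB : zmod_morphism N.
  by move=> c d; rewrite /N phiB mulmxBl col_vec_zmod_morphism.
have N_inj : injective N.
  apply: zmorph_inj => // d Nd0; apply/eqP; apply: contraTT v0 => d0.
  rewrite negbK -[v]mul1mx -[1%:M](phiV d d0) -mulmxA -NE Nd0.
  by rewrite (zmorph0 (coord_col_zmod_morphism e)) mulmx0.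
have [N' NK N'K] : bijective N := @injF_bij F _ N_inj.
(* Thus Y x = N (rho x), and M_a x = T_a (Y x) multiplies [rho x] by [psi a]. *)
pose rho x := N' (B x 1).
have BE x a : B x a = N (psi a * rho x).
  apply: col_inj; rewrite -DO_mx_col NE phiM -mulmxA -NE N'K -DO_mx_col psiE.
  by rewrite mulmxA mulmxKV.
(* [B] is symmetric, so [psi a * rho x = psi x * rho a]; take [a = 1]. *)
have rhoE x : rho x = psi x * rho 1.
  by apply: (can_inj NK); rewrite -BE horner_DeltaC BE psi1 mul1r.
(* Otherwise Y would kill the coordinate vector of 1. *)
have rho1_neq0 : rho 1 != 0.
  apply: contra_neq v0 => rho10; rewrite /v -(mulKmx Y_unit (coord_col e 1)).
  rewrite DO_mx_col BE rho10 mulr0 (zmorph0 NB).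
  by rewrite (zmorph0 (coord_col_zmod_morphism e)) mulmx0.
exists (fun z => N (z * rho 1)), psi; split.
- split; first by move=> y z; rewrite mulrBl NB.
  by apply: (@injF_bij F) => y z /N_inj/(mulIf rho1_neq0).
- by split=> //; exact: (@injF_bij F _ psi_inj).
- by move=> x y; rewrite BE rhoE mulrA [psi y * _]mulrC.
Qed.

End DembowskiOstrom.

Theorem corollary3 (p n : nat) (L : fieldExtType 'F_p) (g : {poly L})
    (e alpha : n.-tuple L) :
  prime p -> odd p -> (0 < n)%N -> \dim {:L} = n ->
  basis_of {:L} e -> basis_of {:L} alpha ->
  dembowski_ostrom n g ->
  let Y := DO_mx e g 1 in
  let A := generated_subring
             (fun i : 'I_n => DO_mx e g (tnth alpha i) *m invmx Y) in
  ea_equivalent n g 'X^2 <->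
    Y \in unitmx /\ (is_subfield A /\ #|A| = (p ^ n)%N).
Proof.
case: n e alpha => // k e alpha p_pr p_odd _ dimL e_basis alpha_basis g_DO Y A.
split=> [/(ea_equivalent_square p_pr p_odd dimL g_DO) g_mul|].
  exact: polar_isotopic_field.
move=> [Y_unit [A_field A_card]].
apply/(ea_equivalent_square p_pr p_odd dimL g_DO).
exact: field_polar_isotopic e_basis alpha_basis Y_unit A_field A_card.
Qed.
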